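(* For every integer $n\geq 1$ and every integer $r\geq 0$, the number of involutions in $\mathfrak{I}_n(132)$ having exactly $r$ rises is $$\binom{\lfloor n/2\rfloor}{\lfloor (r+1)/2\rfloor}\binom{\lfloor (n-1)/2\rfloor}{\lfloor r/2\rfloor}.$$
   Context: $\mathfrak{I}_n(132)$ is the set of involutions $\pi=\pi^{-1}$ in the symmetric group $\mathfrak{S}_n$ (one-line notation $\pi_1\cdots\pi_n$) that avoid the pattern $132$, i.e. have no indices $i<j<k$ with $\pi_i<\pi_k<\pi_j$. A rise of $\pi$ is an index $1\leq j\leq n-1$ with $\pi_j<\pi_{j+1}$. $\lfloor\cdot\rfloor$ is the floor function, and $\binom{a}{b}=0$ if $b<0$ or $b>a$. *)

(* Defs.v *)
From mathcomp Require Import all_boot all_order all_fingroup.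

Set Implicit Arguments.
Unset Strict Implicit.
Unset Printing Implicit Defensive.

(* Permutations of {1, ..., n} are represented by 'S_n, i.e. positions and
   values are shifted by one and range over {0, ..., n-1}. *)

Definition avoids132 n (s : 'S_n) : bool :=
  ~~ [exists i : 'I_n, exists j : 'I_n, exists k : 'I_n,
        [&& i < j, j < k, s i < s k & s k < s j]].

(* The identity is an involution here: the condition is s = s^-1. *)
Definition involutions132 n : {set 'S_n} :=
  [set s : 'S_n | (s == s^-1)%g && avoids132 s].

(* The last position has no successor in 'I_n, hence is never a rise. *)
Definition rises n (s : 'S_n) : {set 'I_n} :=
  [set j : 'I_n | [exists k : 'I_n, (k == j.+1 :> nat) && (s j < s k)]].

(* Main.v *)
(* A 132-avoiding involution is determined by its descent set D, a subset of
   {1, ..., n-1}: its descent bottoms are its left-to-right minima other than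
   the first one, and it permutes its left-to-right minima. The sets D that
   occur are those with |D meet [n-j, n-1]| <= |D meet [1, j]| for all
   j <= (n-1)/2. Reading the pairs (x in D, n-x in D) from the outside in turns
   D into a ballot word of length m = (n-1)/2, and the ballot words with b + c
   elements of D, at most c of them above n/2, number 'C(m, b) * 'C(m, c)
   when c <= b. For n even the central point n/2 is free, which costs one more
   use of Pascal's rule. *)
Require Import Defs.
From mathcomp Require Import all_boot all_order all_fingroup.
From mathcomp Require Import zify.

Set Implicit Arguments.
Unset Strict Implicit.
Unset Printing Implicit Defensive.

(** * 132-avoiding involutions and their descents *)

(** Functions on [nat] that fix everything from [n] on let [n] vary in an induction without casts
    between ordinal types. *)
Definition inv132 (n : nat) (f : nat -> nat) : Prop :=
  [/\ involutive f, forall i, n <= i -> f i = i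
    & forall i j k, i < j -> j < k -> f i < f k -> f k < f j -> False].

(* Positions start at 0, so that [desc f i] compares [i.-1] and [i]; this is the
   usual set of descents of the one-line notation indexed from 1. *)
Definition desc (f : nat -> nat) : pred nat := fun i => (0 < i) && (f i < f i.-1).

Definition ballot (n : nat) (D : pred nat) : Prop :=
  forall j, j <= n.-1./2 -> count D (iota (n - j) j) <= count D (iota 1 j).

Section Involution.

Variables (n : nat) (f : nat -> nat).
Hypothesis hf : inv132 n f.

Lemma inv132K : involutive f. Proof. by case: hf. Qed.

Lemma inv132_inj : injective f. Proof. exact: inv_inj inv132K. Qed.

Lemma inv132_ltn i : i < n -> f i < n.
Proof.
case: hf => fK ffix _ lin; rewrite ltnNge; apply/negP => le.
by have := ffix _ le; rewrite fK; lia.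
Qed.

(** Otherwise [j], [i.-1], [i] would form the pattern 132. Hence descent bottoms are left-to-right
    minima. *)
Lemma desc_lt i j : desc f i -> j < i -> f i < f j.
Proof.
case/andP => i0 di ji; rewrite ltnNge leq_eqVlt negb_or; apply/andP; split.
  by apply/eqP => /inv132_inj; lia.
apply/negP => lt; have [e|ne] := eqVneq j i.-1; first by move: lt; rewrite e; lia.
by case: hf => _ _ /(_ j i.-1 i); apply=> //; lia.
Qed.

(** Left-to-right minima are the points with nothing below and to the left, a condition symmetric
    under inversion. Position 0 is exceptional because it has no predecessor. *)
Lemma desc_image i : desc f i -> f i = 0 \/ desc f (f i).
Proof.
move=> di; have [->|fi0] := posnP (f i); first by left.
right; rewrite /desc fi0 inv132K /= ltnNge leq_eqVlt negb_or; apply/andP; split.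
  by apply/eqP => e; have := inv132K (f i).-1; rewrite e; lia.
by apply/negP => /(desc_lt di); rewrite inv132K; lia.
Qed.

Lemma desc_image0 : f 0 = 0 \/ desc f (f 0).
Proof.
have [->|f0] := posnP (f 0); first by left.
right; rewrite /desc f0 inv132K /= lt0n; apply/eqP => e.
by have := inv132K (f 0).-1; rewrite e; lia.
Qed.

Lemma desc_max i : desc f i -> i <= f 0.
Proof. by move=> di; rewrite leqNgt; apply/negP => /(desc_lt di); rewrite inv132K. Qed.

Lemma desc_bound i : desc f i -> 0 < i < n.
Proof.
case: hf => fK ffix _ /[dup] di /andP[-> d] /=; rewrite ltnNge; apply/negP => le.
move: d; rewrite (ffix i) //; case: (leqP n i.-1) => [/ffix->|/inv132_ltn]; lia.
Qed.

(* The first position [q] whose value is below [n - j] is a left-to-right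
   minimum, and [q <= j] because the earlier values all lie in [n - j, n).
   The left-to-right minima [i >= n - j] are mapped to minima before [q]. *)
Lemma desc_ballot : ballot n (desc f).
Proof.
move=> j jm; have [e|n0] := posnP n; first by have -> : j = 0 by lia.
have fK := inv132K.
have exq : exists q, f q < n - j by exists (f 0); rewrite fK; lia.
case: (ex_minnP exq) => q fq qmin.
have before i : i < q -> n - j <= f i.
  by move=> iq; rewrite leqNgt; apply/negP => /qmin; lia.
have qj : q <= j.
  suff: size (map f (iota 0 q)) <= size (iota (n - j) j) by rewrite size_map !size_iota.
  apply: uniq_leq_size => [|x /mapP[i]]; first by rewrite (map_inj_uniq inv132_inj) iota_uniq.
  rewrite !mem_iota => /= iq ->; rewrite before //=.
  have qn : q <= n by apply: leq_trans (qmin (f 0) _) _; [rewrite fK; lia | apply/ltnW/inv132_ltn].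
  have := @inv132_ltn i; lia.
pose M i := (i == 0) || desc f i.
have Mq : M q.
  rewrite /M; have [//|q0] := posnP q; rewrite /desc q0 /=.
  by have := before q.-1; lia.
have le1 : count (desc f) (iota (n - j) j) <= count M (iota 0 q).
  rewrite -!size_filter -(size_map f); apply: uniq_leq_size => [|x /mapP[i]].
    by rewrite (map_inj_uniq inv132_inj) filter_uniq ?iota_uniq.
  rewrite !mem_filter !mem_iota => /and3P[di le _] ->; rewrite add0n /=; apply/andP; split.
    by case: (desc_image di) => [->//|]; rewrite /M => ->; rewrite orbT.
  rewrite ltnNge leq_eqVlt negb_or; apply/andP; split; apply/negP.
    by move/eqP => e; move: fq; rewrite e fK; lia.
  case: (desc_image di) => [->//|dfi] /(desc_lt dfi); rewrite fK; lia.
apply: leq_trans le1 _.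
have -> : count (desc f) (iota 1 j) = count M (iota 1 j).
  by apply/eq_in_count => i; rewrite mem_iota /M; case: i.
have -> : iota 1 j = iota 1 q ++ iota q.+1 (j - q) by rewrite -[in LHS](subnKC qj) iotaD.
rewrite count_cat; apply: leq_trans (leq_addr _ _).
(* Passing from [[0, q)] to [[1, q]] loses the minimum at [0] and gains the one at [q]. *)
have := congr1 (count M) (iotaD 0 q 1); rewrite addn1 count_cat /= Mq; lia.
Qed.

End Involution.

(** * Uniqueness of the involution with given descents *)

(* At the first difference [i], with [f i < g i]: if [i] is not a
   left-to-right minimum then [g] contains 132; otherwise [f (g i)] is a
   left-to-right minimum of both, which contradicts its position. *)
Lemma inv132_eq_lt n f g : inv132 n f -> inv132 n g -> desc f =1 desc g ->
  forall i, (forall j, j < i -> f j = g j) -> f i < g i -> False.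
Proof.
move=> hf hg dfg i eqfg lt.
have fK := inv132K hf; have gK := inv132K hg.
have [di|ndi] := boolP ((i == 0) || desc g i).
  have dgi : desc g (g i).
    case/orP: di => [/eqP e|/(desc_image hg)[]//]; last lia.
    by subst i; case: (desc_image0 hg) => //; lia.
  rewrite -dfg in dgi; case: (desc_image hf dgi) => [e|d].
    move: (fK (g i)); rewrite e => e0; move: lt.
    have [z|i0] := posnP i; first by rewrite z in e0 *; lia.
    by move: (eqfg 0 i0); rewrite e0 => /(inv132_inj hg); lia.
  case: (ltngtP (f (g i)) i) => [l|l|e].
  - by move: (eqfg _ l); rewrite fK => /(inv132_inj hg); lia.
  - by have := desc_lt hf d l; rewrite fK; lia.
  - by move: lt; rewrite -{1}e fK; lia.
move: ndi; rewrite negb_or -dfg /desc; case: i eqfg lt => //= i eqfg lt.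
rewrite -leqNgt leq_eqVlt => /orP[/eqP/(inv132_inj hf)|lt']; first lia.
have ltg : i.+1 < g (f i.+1).
  rewrite ltnNge leq_eqVlt negb_or; apply/andP; split; apply/negP.
    by move/eqP/(congr1 g); rewrite gK; lia.
  by move=> l; move: (eqfg _ l); rewrite gK => /(inv132_inj hf); lia.
(* The third position is the one where [g] takes the value [f i.+1], which lies between [g i] and
   [g i.+1]. *)
case: hg => _ _ /(_ i i.+1 (g (f i.+1))); apply=> //; rewrite gK //.
by rewrite -eqfg.
Qed.

Lemma inv132_desc_inj n f g : inv132 n f -> inv132 n g -> desc f =1 desc g -> f =1 g.
Proof.
move=> hf hg dfg; elim/ltn_ind => i IH.
case: (ltngtP (f i) (g i)) => // [/(inv132_eq_lt hf hg dfg)|/(inv132_eq_lt hg hf _)] [] //.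
by move=> j /IH.
Qed.

(** * Existence: adding outer hooks *)

(* The Lehmer code of a 132-avoiding involution is a self-conjugate partition;
   this adds to that of [g] an outer hook of arm and leg length [v]. *)
Definition hook (v : nat) (g : nat -> nat) (i : nat) : nat :=
  if i == 0 then v.+1 else if i == v.+1 then 0
  else let y := g (if i <= v then i.-1 else i.-2) in if y < v then y.+1 else y.+2.

Section Hook.

Variables (n v : nat) (g : nat -> nat).
Hypotheses (hg : inv132 n g) (gv : g 0 <= v) (vn : v <= n).

(** The increasing bijection from [nat] onto the complement of [0] and [v.+1]; [hook v g] swaps
    these two points and is the conjugate of [g] by [skip] elsewhere. *)
Definition skip (j : nat) : nat := if j < v then j.+1 else j.+2.

Ltac skip_lia := rewrite /skip; repeat case: ifP; lia.

Lemma hook_v : hook v g v.+1 = 0. Proof. by rewrite /hook /= eqxx. Qed.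

Lemma hook_skip j : hook v g (skip j) = skip (g j).
Proof.
rewrite /hook; have -> : (if skip j <= v then (skip j).-1 else (skip j).-2) = j.
  by skip_lia.
by have [-> ->] : (skip j == 0) = false /\ (skip j == v.+1) = false by skip_lia.
Qed.

Variant hook_spec : nat -> nat -> Prop :=
  | HookZero : hook_spec 0 v.+1
  | HookTop : hook_spec v.+1 0
  | HookSkip j : hook_spec (skip j) (skip (g j)).

Lemma hookP i : hook_spec i (hook v g i).
Proof.
have [->|i0] := posnP i; first exact: HookZero.
have [->|iv] := eqVneq i v.+1; first by rewrite hook_v; exact: HookTop.
have -> : i = skip (if i <= v then i.-1 else i.-2) by skip_lia.
by rewrite hook_skip; exact: HookSkip.
Qed.

Lemma inv132_hook : inv132 n.+2 (hook v g).
Proof.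
have [gK gfix g132] := hg; have ginj := inv132_inj hg.
have skip_lt a b : (skip a < skip b) = (a < b) by skip_lia.
have skip_gt a : (v.+1 < skip a) = (v <= a) by skip_lia.
have min0 a : v <= g a -> 0 < a -> g 0 < g a.
  by move=> h a0; have : g a <> g 0 by [move/ginj; lia]; lia.
split=> [i|i le|i j k].
- by case: (hookP i) => [||j]; rewrite ?hook_v // hook_skip gK.
- have -> : i = skip i.-2 by skip_lia.
  by rewrite hook_skip gfix //; lia.
case: (hookP i) => [||{}i]; case: (hookP j) => [||{}j]; case: (hookP k) => [||{}k] //;
  rewrite ?ltnn ?skip_lt ?skip_gt //.
(* The new point at position [0] plays the 1 of the pattern; position [0] of [g] replaces it, as
   [g 0 <= v]. *)
- move=> _ jk vk kj; have [j0|j0] := posnP j; first by subst j; lia.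
  by apply: (g132 0 j k) => //; apply: min0 => //; lia.
(* The new point at position [v.+1] plays the 1: this is the previous case reflected by
   inversion. *)
- move=> vj jk _ kj; have [k0|k0] := posnP (g k).
    by move: (gK k); rewrite k0 => e; move: gv; rewrite e; lia.
  apply: (g132 0 (g k) (g j)) => //; rewrite ?gK //.
  by have := @min0 (g j); rewrite gK; apply=> //; lia.
- exact: g132.
Qed.

(** [g] has no descent beyond [g 0 <= v], so the hook has none past [v.+1], where its value is 0.
    For [0 < v], the value [skip (g 0)] at 1 is below [v.+1] exactly when [g 0 < v]. *)
Lemma desc_hook i :
  desc (hook v g) i = [|| i == v.+1, (i == 1) && (g 0 < v) | [&& 1 < i, i <= v & desc g i.-1]].
Proof.
case: i => [//|i]; rewrite /desc /=.
case: i => [|i].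
  have h0 : hook v g 0 = v.+1 by [].
  case: (posnP v) => [e|v0]; first by move: hook_v h0; rewrite e /= => -> ->; lia.
  have e1 : 1 = skip 0 by skip_lia.
  rewrite [in hook v g 1]e1 hook_skip h0; skip_lia.
case: (ltngtP i.+1 v) => h.
- have -> : hook v g i.+2 = skip (g i.+1) by rewrite -hook_skip; congr hook; skip_lia.
  have -> : hook v g i.+1 = skip (g i) by rewrite -hook_skip; congr hook; skip_lia.
  rewrite /=; skip_lia.
- have [->|ne] := eqVneq i v; first by rewrite hook_v; lia.
  have -> : hook v g i.+2 = skip (g i) by rewrite -hook_skip; congr hook; skip_lia.
  have -> : hook v g i.+1 = skip (g i.-1) by rewrite -hook_skip; congr hook; skip_lia.
  have : ~~ desc g i by apply/negP => /(desc_max hg); lia.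
  rewrite /desc /=; skip_lia.
have -> : hook v g i.+1 = skip (g i) by rewrite -hook_skip; congr hook; skip_lia.
rewrite h hook_v eqxx; skip_lia.
Qed.

End Hook.

Lemma count_lt (T : eqType) (P Q : pred T) (s : seq T) (x : T) :
  subpred P Q -> x \in s -> Q x -> ~~ P x -> count P s < count Q s.
Proof.
move=> PQ xs Qx nPx; elim: s xs => //= y s IH; rewrite inE => /predU1P[<-|/IH].
  by rewrite (negbTE nPx) Qx !add0n add1n ltnS sub_count.
by have := PQ y; case: (P y) => [->|_] //; case: (Q y); lia.
Qed.

(* Peeling off the outer hook removes [mu = max D] and, when [1 \in D], [1]
   itself; the remaining descents move down by one. *)
Lemma ballot_desc (n : nat) (D : pred nat) :
  (forall i, D i -> 0 < i < n) -> ballot n D -> exists2 f, inv132 n f & desc f =1 D.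
Proof.
elim/ltn_ind: n D => n IH D Dn bD.
have [hasD|/hasPn noD] := boolP (has D (iota 0 n)); last first.
  exists id => [|i]; first by split=> // i j k; lia.
  rewrite /desc; have [Di|_] := boolP (D i); last by rewrite /=; lia.
  by have := noD i; rewrite mem_iota Di; have := Dn _ Di; lia.
have exD : exists i, D i by case/hasP: hasD => i _ Di; exists i.
have Dle i : D i -> i <= n by move/Dn; lia.
case: (ex_maxnP exD Dle) => mu Dmu mumax {exD Dle hasD}.
have mun := Dn _ Dmu.
case: n => [|[|n]] in IH Dn bD mun *; [lia | lia |].
have D0 : D 0 = false by apply/negP => /Dn.
have D1 : ~~ D 1 -> ~~ D n.+1.
  move=> nD1; have [n0|n0] := posnP n; first by rewrite n0.
  by have := bD 1; rewrite subSS subn0 /= (negbTE nD1); lia.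
(* [mu] is dropped only if [D 1] holds. Otherwise [mu.-1] stays a descent of [g], which forces
   [g 0 = mu.-1], and then the hook has no descent at 1. *)
pose D' i := [&& 0 < i, D i.+1 & ~~ (D 1 && (i.+1 == mu))].
have D'n i : D' i -> 0 < i < n.
  case/and3P=> -> Di; have := Dn _ Di; have [e|ne] := eqVneq i n; last lia.
  move: Di; rewrite e => Dn1; have [_|/D1] := boolP (D 1); last by rewrite Dn1.
  by have := mumax _ Dn1; case: eqP; lia.
have bD' : ballot n D'.
  case=> [|k] kn; first by rewrite /=.
  move: k.+1 kn (ltn0Sn k) => j jn j0; have := bD j.+1; rewrite subSS => bDj.
  have shift a : count D' (iota a j) = count (D' \o predn) (iota a.+1 j).
    by rewrite -addn1 addnC iotaDl count_map; apply: eq_count.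
  have nj : n.+1 - j = (n - j).+1 by lia.
  have eR : count D (iota (n.+1 - j) j.+1) = count D (iota (n - j).+1 j) + D n.+1.
    by rewrite nj -[j.+1]addn1 iotaD count_cat /= addn0; congr (_ + D _); lia.
  move: bDj; rewrite eR /= => bDj.
  have {bDj} : count D (iota (n - j).+1 j) + D n.+1 <= D 1 + count D (iota 2 j) by apply: bDj; lia.
  have le : count D' (iota (n - j) j) <= count D (iota (n - j).+1 j).
    by rewrite shift; apply: sub_count => -[|i] //= /and3P[].
  have eL : (D 1 -> j.+1 < mu) -> count D' (iota 1 j) = count D (iota 2 j).
    move=> jmu; rewrite shift; apply/eq_in_count => -[|i]; rewrite mem_iota //= /D'.
    by case: (D 1) jmu => //; lia.
  have [d1|nd1] := boolP (D 1); last first.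
    by rewrite eL ?(negbTE nd1) //=; lia.
  (* An empty right window asks nothing. Otherwise it contains some [i < mu], so [mu] is past the
     left window and its removal leaves the left count unchanged. *)
  case: (posnP (count D' (iota (n - j) j))) => [->//|].
  rewrite shift -has_count => /hasP[i]; rewrite mem_iota /= => ij /and3P[i0].
  have -> : i.-1.+1 = i by lia.
  rewrite d1 /= => Di imu.
  have mi := mumax _ Di.
  rewrite eL; last by lia.
  (* The extra unit [D 1] in the bound is absorbed by [D n.+1], or else by [mu], which is then
     removed from the right window. *)
  have [dn|dn] := boolP (D n.+1); first by rewrite shift in le; lia.
  suff : count (D' \o predn) (iota (n - j).+1 j) < count D (iota (n - j).+1 j) by lia.
  apply: (@count_lt _ _ _ _ mu) => //=.
  - by case=> [|y] //= /and3P[].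
  - have : mu != n.+1 by apply: contraNneq dn => <-.
    by rewrite mem_iota; lia.
  - by rewrite /D' d1 prednK ?eqxx ?andbF //; lia.
have [|g hg dg] := IH n _ D' D'n bD'; first lia.
have gmu : g 0 <= mu.-1.
  case: (desc_image0 hg) => [->//|]; rewrite dg => /and3P[_ /mumax]; lia.
exists (hook mu.-1 g) => [|i]; first by apply: inv132_hook => //; lia.
rewrite (desc_hook hg) //; last lia.
rewrite dg prednK; last lia.
case: i => [|[|i]]; first by rewrite D0; lia.
  rewrite /= orbF; have [d1|nd1] := boolP (D 1).
    case: (eqVneq 1 mu) => //= ne; case: (desc_image0 hg) => [->|]; first lia.
    by rewrite dg /D' d1 => /and3P[_ _]; lia.
  have ne : 1 != mu by apply: contraNneq nd1 => ->.
  suff : mu.-1 <= g 0 by lia.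
  apply: (desc_max hg); rewrite dg /D' (negbTE nd1) prednK ?Dmu; lia.
have [->|ne] := eqVneq i.+2 mu; first by rewrite Dmu.
rewrite /D' /= (negbTE ne) andbF andbT.
by have := mumax i.+2; case: (D _) => [/(_ isT)|_]; lia.
Qed.

(** * Ballot words and their enumeration *)

Notation pairs := (seq (bool * bool)).

(* The head of the list is the innermost pair. *)
Fixpoint word (n : nat) (D : pred nat) (m : nat) : pairs :=
  if m is m'.+1 then (D m, D (n - m)) :: word n D m' else [::].

Fixpoint balanced (s : pairs) : bool :=
  if s is p :: s' then
    (count snd s <= count fst s) && balanced s'
  else true.

Lemma size_word n D m : size (word n D m) = m.
Proof. by elim: m => //= m ->. Qed.

Lemma nth_word n D m i : i < m ->
  nth (false, false) (word n D m) i = (D (m - i), D (n - (m - i))).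
Proof. by elim: m i => // m IH [|i] //= im; rewrite IH. Qed.

Lemma count_fst_word n D m : count fst (word n D m) = count D (iota 1 m).
Proof. by elim: m => // m IH; rewrite -[in RHS](addn1 m) iotaD count_cat -IH /= addn0 addnC. Qed.

Lemma count_snd_word n D m : m <= n -> count snd (word n D m) = count D (iota (n - m) m).
Proof. by elim: m => //= m IH mn; rewrite IH; last lia; rewrite -subSn // subSS. Qed.

(** The suffixes of a word are the words of smaller [m], so [balanced] tests one ballot inequality
    for each [j]. *)
Lemma ballot_word n D : reflect (ballot n D) (balanced (word n D n.-1./2)).
Proof.
rewrite /ballot; have : n.-1./2 <= n by lia.
elim: n.-1./2 => [|m IH] mn; first by apply: ReflectT => -[].
have {}IH := IH (ltnW mn).
rewrite -[balanced _]/((count snd (word n D m.+1) <= count fst (word n D m.+1)) && _).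
rewrite count_snd_word // count_fst_word.
apply: (iffP andP) => [[le /IH h] j|h].
  by rewrite leq_eqVlt => /predU1P[->//|/h].
by split; [exact: h | apply/IH => j jm; apply: h; exact: leqW].
Qed.

Fixpoint words (m : nat) : seq pairs :=
  if m is m'.+1 then
    [seq p :: s | p <- [:: (false, false); (true, false); (false, true); (true, true)],
                  s <- words m']
  else [:: [::]].

Lemma words_uniq m : uniq (words m).
Proof. by elim: m => // m IH; apply: allpairs_uniq => // -[x s] [y t] _ _ [-> ->]. Qed.

Lemma mem_words m s : (s \in words m) = (size s == m).
Proof.
elim: m s => [|m IH] [|p s] //.
  by apply/allpairsP => -[[q t] []].
rewrite [size _]/= eqSS -IH; apply/allpairsP/idP => [[[q t] [_ /= h [_ ->]]]//|h].
by exists (p, s); split=> //; case: p => -[] [].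
Qed.

Lemma count_words m (P : pred pairs) : count P (words m.+1) =
  count (fun s => P ((false, false) :: s)) (words m)
  + count (fun s => P ((true, false) :: s)) (words m)
  + count (fun s => P ((false, true) :: s)) (words m)
  + count (fun s => P ((true, true) :: s)) (words m).
Proof. by rewrite /= !count_cat !count_map /= addn0 !addnA. Qed.

Definition within (b c : nat) (s : pairs) : bool :=
  [&& balanced s, count fst s + count snd s == b + c & count snd s <= c].

Lemma balanced_le s : balanced s -> count snd s <= count fst s.
Proof. by case: s => //= p s /andP[]. Qed.

(* For [c <= b] the bound on [snd] forces the last ballot inequality, so that
   Pascal's rule applies; [c = b.+1] reduces to [c = b] by symmetry. *)
Lemma count_within m b c : c <= b.+1 -> count (within b c) (words m) = 'C(m, b) * 'C(m, c).
Proof.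
have red b' m' : count (within b' b'.+1) (words m') = count (within b'.+1 b') (words m').
  apply: eq_count => s; rewrite /within; have := @balanced_le s.
  by case: balanced => //= /(_ isT); lia.
elim: m b c => [|m IH] b c cb.
  by rewrite /= /within /=; case: b c cb => [|b] [|c].
wlog le : b c cb / c <= b.
  move=> H; have [//|lt] := leqP c b; first exact: H.
  have -> : c = b.+1 by lia.
  by rewrite (red b m.+1) (H b.+1 b) 1?mulnC //; lia.
rewrite count_words.
have E p : count (fun s => within b c (p :: s)) (words m) =
    if (p.1 <= b) && (p.2 <= c) then 'C(m, b - p.1) * 'C(m, c - p.2) else 0.
  case: ifP => [/andP[p1 p2]|np]; last first.
    apply/eqP; rewrite -leqn0 leqNgt -has_count; apply/hasPn => s _; apply: contraFN np.
    by rewrite /within /= -!andbA => /and4P[]; case: p => -[] [] /=; lia.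
  (* At [p = (true, false)] with [b = c], the remaining bounds satisfy only [c = (b - 1) + 1], which
     is why the statement admits [c = b.+1]. *)
  rewrite -IH; last by case: p {p1 p2} => -[] [] /=; lia.
  apply: eq_count => s; rewrite /within /=; have := @balanced_le s.
  by case: balanced => /= [/(_ isT)|_]; case: p p1 p2 => -[] [] /=; lia.
rewrite !E; case: b c cb le {E} => [|b] [|c] //= _ _;
  rewrite ?subSS ?subn0 ?binS ?bin0 ?muln1 ?addn0 //.
rewrite mulnDl !mulnDr; lia.
Qed.

(** Balance and the total [t] already force [count snd s <= t./2], so these are the words
    [within (uphalf t) t./2]. *)
Lemma count_balanced m t :
  count (fun s => balanced s && (count fst s + count snd s == t)) (words m)
  = 'C(m, uphalf t) * 'C(m, t./2).
Proof.
rewrite -count_within; last by lia.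
apply: eq_count => s; rewrite /within; have := @balanced_le s.
by case: balanced => //= /(_ isT); lia.
Qed.

(** * Coding descent sets by words *)

(* A predicate on (0, n) is encoded by its pairs of values at [x] and [n - x],
   plus its value at the centre [n./2] when [n] is even. *)
Definition encode (n : nat) (D : pred nat) : pairs * bool :=
  (word n D n.-1./2, D n./2 && ~~ odd n).

Lemma eq_encode n (D E : pred nat) : D =1 E -> encode n D = encode n E.
Proof.
move=> DE; rewrite /encode DE; congr pair.
by elim: n.-1./2 => //= m ->; rewrite !DE.
Qed.

(** Codes of the sets with [n.-1 - r] elements, one for each non-rise; the additive form leaves none
    when [r > n.-1]. *)
Definition codes (n r : nat) : seq (pairs * bool) :=
  let P c s := balanced s && (count fst s + count snd s + c + r == n.-1) in
  [seq (s, false) | s <- words n.-1./2 & P 0 s] ++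
  (if odd n then [::] else [seq (s, true) | s <- words n.-1./2 & P 1 s]).

Lemma mem_codes n r s c : ((s, c) \in codes n r) =
  [&& size s == n.-1./2, balanced s, c ==> ~~ odd n & count fst s + count snd s + c + r == n.-1].
Proof.
have inj (d : bool) : injective (fun s : pairs => (s, d)) by move=> x y [].
rewrite /codes mem_cat; case: c.
  have -> /= : (s, true) \in [seq (s, false) | s <- words n.-1./2
      & balanced s && (count fst s + count snd s + 0 + r == n.-1)] = false.
    by apply/mapP => -[].
  case: odd; first by rewrite !andbF.
  by rewrite (mem_map (inj _)) mem_filter mem_words andbC.
have -> : (s, false) \in (if odd n then [::] else [seq (s, true) | s <- words n.-1./2
      & balanced s && (count fst s + count snd s + 1 + r == n.-1)]) = false.
  by case: odd => //; apply/mapP => -[].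
by rewrite orbF (mem_map (inj _)) mem_filter mem_words andbC.
Qed.

Lemma codes_uniq n r : uniq (codes n r).
Proof.
have inj (d : bool) : injective (fun s : pairs => (s, d)) by move=> x y [].
rewrite /codes cat_uniq (map_inj_uniq (inj _)) filter_uniq ?words_uniq //=.
case: odd => //; rewrite (map_inj_uniq (inj _)) filter_uniq ?words_uniq // andbT.
by apply/hasPn => _ /mapP[s _ ->]; apply/mapP => -[].
Qed.

(** The symmetry of binomials turns counts of descents into counts of rises. For [n] even, the two
    values of the centre give the two terms of Pascal's rule. *)
Lemma size_codes n r : 0 < n ->
  size (codes n r) = 'C(n %/ 2, (r + 1) %/ 2) * 'C((n - 1) %/ 2, r %/ 2).
Proof.
move=> n0; have cnt c t : t + c + r = n.-1 ->
    size [seq s <- words n.-1./2 | balanced s && (count fst s + count snd s + c + r == n.-1)]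
    = 'C(n.-1./2, uphalf t) * 'C(n.-1./2, t./2).
  move=> e; rewrite size_filter -count_balanced; apply: eq_count => s.
  by rewrite -e !eqn_add2r.
have cnt0 c : n.-1 < c + r ->
    size [seq s <- words n.-1./2 | balanced s && (count fst s + count snd s + c + r == n.-1)] = 0.
  move=> lt; apply/eqP; rewrite size_filter -leqn0 leqNgt -has_count; apply/hasPn => s _.
  by rewrite negb_and; apply/orP; right; lia.
rewrite /codes size_cat size_map; have [on|en] := boolP (odd n).
  have -> : n %/ 2 = n.-1./2 by lia.
  have -> : (n - 1) %/ 2 = n.-1./2 by lia.
  rewrite addn0; have [le|lt] := leqP r n.-1; last first.
    by rewrite cnt0 // (@bin_small _ ((r + 1) %/ 2)); lia.
  rewrite (@cnt 0 (n.-1 - r)); last by lia.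
  rewrite mulnC -(@bin_sub n.-1./2 (uphalf _)); last by lia.
  rewrite -(@bin_sub n.-1./2 (_./2)); last by lia.
  by congr ('C(_, _) * 'C(_, _)); lia.
rewrite size_map; set m := n.-1./2 in cnt cnt0 *.
have -> : n %/ 2 = m.+1 by lia.
have -> : (n - 1) %/ 2 = m by lia.
have [le|lt] := leqP r n.-1; last first.
  by rewrite !cnt0 ?(@bin_small _ (r %/ 2)) ?muln0 //; lia.
have -> : r %/ 2 = m - (n.-1 - r)./2 by lia.
have -> : (r + 1) %/ 2 = m.+1 - uphalf (n.-1 - r) by lia.
rewrite !bin_sub; try lia.
rewrite (@cnt 0 (n.-1 - r)); last by lia.
(* Without descents the centre cannot be taken, and [uphalf 0] is not a successor to which Pascal's
   rule could apply. *)
have [e|ne] := eqVneq r n.-1; first by rewrite cnt0 ?e ?subnn ?bin0; lia.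
rewrite (@cnt 1 (n.-1 - r).-1); last by lia.
have -> : uphalf (n.-1 - r).-1 = (n.-1 - r)./2 by lia.
have -> : uphalf (n.-1 - r) = (n.-1 - r).-1./2.+1 by lia.
by rewrite binS mulnDl [X in _ + X]mulnC.
Qed.

Lemma encode_inj n (D E : pred nat) :
  (forall i, D i -> 0 < i < n) -> (forall i, E i -> 0 < i < n) ->
  encode n D = encode n E -> D =1 E.
Proof.
move=> Dn En [ew ec] i; have [/andP[i0 lin]|ni] := boolP (0 < i < n); last first.
  by apply/idP/idP => [/Dn|/En]; rewrite (negbTE ni).
have nthw k : k < n.-1./2 -> D (n.-1./2 - k) = E (n.-1./2 - k) /\
    D (n - (n.-1./2 - k)) = E (n - (n.-1./2 - k)).
  by move=> km; have := congr1 (nth (false, false) ^~ k) ew; rewrite !nth_word // => -[].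
have [le|lt] := leqP i n.-1./2.
  by have [|+ _] := @nthw (n.-1./2 - i); [lia | rewrite subKn].
have [le|lt'] := leqP (n - i) n.-1./2.
  by have [|_ +] := @nthw (n.-1./2 - (n - i)); [lia | rewrite !subKn //; lia].
have ei : i = n./2 by lia.
have en : ~~ odd n by lia.
by move: ec; rewrite en !andbT -ei.
Qed.

Lemma encode_surj n s (c : bool) : 0 < n -> size s = n.-1./2 -> (c -> ~~ odd n) ->
  exists2 D : pred nat, (forall i, D i -> 0 < i < n) & encode n D = (s, c).
Proof.
move=> n0 ss cn; pose m := n.-1./2.
(* The head is the innermost pair, so the pair of [x] and [n - x] has index [m - x]. The last branch
   is reached inside [(0, n)] only at the centre, for [n] even. *)
exists (fun i => (0 < i < n) && (if i <= m then (nth (false, false) s (m - i)).1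
    else if n - i <= m then (nth (false, false) s (m - (n - i))).2 else c)).
  by move=> i /andP[].
congr pair; last first.
  have [on|en] := boolP (odd n); first by rewrite andbF; case: c cn => // /(_ isT); rewrite on.
  rewrite andbT.
  by do 2 (case: ifP; first lia); have -> : 0 < n./2 < n by lia.
apply: (@eq_from_nth _ (false, false)) => [|i]; rewrite size_word // => im.
rewrite nth_word // -/m; have im' : i < m := im.
have -> : 0 < m - i < n by lia.
have -> : 0 < n - (m - i) < n by lia.
rewrite leq_subr (_ : n - (m - i) <= m = false); last by lia.
rewrite (subKn (ltnW im')) (_ : n - (n - (m - i)) = m - i); last by lia.
by rewrite leq_subr (subKn (ltnW im')) /=; case: nth.
Qed.

Lemma count_encode n (D : pred nat) : 0 < n -> (forall i, D i -> 0 < i < n) ->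
  count fst (encode n D).1 + count snd (encode n D).1 + (encode n D).2 = count D (iota 1 n.-1).
Proof.
move=> n0 Dn; rewrite /= count_fst_word count_snd_word; last lia.
set m := n.-1./2; have [on|en] := boolP (odd n).
  rewrite andbF addn0 -count_cat; congr count.
  have -> : n - m = 1 + m by lia.
  by rewrite -iotaD; congr iota; lia.
rewrite andbT.
have -> : n.-1 = m + m.+1 by lia.
have -> : n - m = m.+2 by lia.
have -> : n./2 = m.+1 by lia.
by rewrite iotaD count_cat /= -addnA [X in _ + X = _]addnC.
Qed.

(** * Transfer to permutations and the final count *)

Definition natfun n (s : 'S_n) (i : nat) : nat := if insub i is Some o then val (s o) else i.

Lemma natfun_ord n (s : 'S_n) (o : 'I_n) : natfun s o = s o.
Proof. by rewrite /natfun valK. Qed.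

Lemma natfun_out n (s : 'S_n) i : n <= i -> natfun s i = i.
Proof. by move=> ni; rewrite /natfun insubF // ltnNge ni. Qed.

Lemma natfun_inj n (s t : 'S_n) : natfun s =1 natfun t -> s = t.
Proof. by move=> e; apply/permP => o; apply/val_inj; rewrite /= -!natfun_ord e. Qed.

Lemma natfun_inv132 n (s : 'S_n) : s \in involutions132 n -> inv132 n (natfun s).
Proof.
rewrite inE => /andP[/eqP sV av].
have sK o : s (s o) = o by rewrite {1}sV permK.
have lt_n i : i < n -> natfun s i < n by move=> lin; rewrite (natfun_ord s (Ordinal lin)).
split=> [i||i j k ij jk lt1 lt2]; last 1 first.
- have kn : k < n.
    rewrite ltnNge; apply/negP => nk; move: lt2; rewrite (natfun_out _ nk).
    by case: (leqP n j) => [/natfun_out->|/lt_n]; lia.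
  have jn : j < n by lia.
  have lin : i < n by lia.
  move/negP: av; apply.
  apply/existsP; exists (Ordinal lin); apply/existsP; exists (Ordinal jn).
  apply/existsP; exists (Ordinal kn); apply/and4P; split=> //=.
    by move: lt1; rewrite (natfun_ord s (Ordinal lin)) (natfun_ord s (Ordinal kn)).
  by move: lt2; rewrite (natfun_ord s (Ordinal jn)) (natfun_ord s (Ordinal kn)).
- have [ni|lin] := leqP n i; first by rewrite !natfun_out.
  by rewrite (natfun_ord s (Ordinal lin)) natfun_ord sK.
- exact: natfun_out.
Qed.

Lemma inv132_natfun n f : inv132 n f ->
  exists2 s : 'S_n, s \in involutions132 n & natfun s =1 f.
Proof.
move=> hf; have fn (o : 'I_n) : f o < n by exact: inv132_ltn hf _ (ltn_ord o).
have finj : injective (fun o : 'I_n => Ordinal (fn o)).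
  by move=> x y /(congr1 val) /= /(inv132_inj hf) /val_inj.
have [fK ffix f132] := hf.
have sE o : perm finj o = f o :> nat by rewrite permE.
exists (perm finj).
  rewrite inE; apply/andP; split.
    rewrite eq_sym eq_invg_mul; apply/eqP/permP => o; apply/val_inj.
    by rewrite permM perm1 /= !sE fK.
  apply/existsPn => i; apply/existsPn => j; apply/existsPn => k.
  by apply/negP => /and4P[ij jk]; rewrite !sE; exact: f132.
move=> i; have [ni|lin] := leqP n i; first by rewrite natfun_out // ffix.
by rewrite (natfun_ord _ (Ordinal lin)) sE.
Qed.

(** Neighbouring values differ, so a rise at [j], counted from 0, is a non-descent at [j.+1] in the
    convention of [desc]. *)
Lemma card_rises n (s : 'S_n) : #|rises s| + count (desc (natfun s)) (iota 1 n.-1) = n.-1.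
Proof.
case: n s => [|n] s; first by rewrite /= addn0; apply/eqP; rewrite cards_eq0; apply/eqP/setP => -[].
have -> : #|rises s| = count (predC (desc (natfun s))) (iota 1 n).
  have -> : #|rises s| = count (fun i => (i < n) && (natfun s i < natfun s i.+1)) (iota 0 n.+1).
    rewrite cardE size_filter -val_enum_ord count_map enumT; apply: eq_count => i.
    rewrite !inE /= natfun_ord; apply/existsP/andP => [[k /andP[/eqP e lt]]|[lin]].
      by rewrite -e natfun_ord -ltnS ltn_ord.
    rewrite -ltnS in lin; rewrite (natfun_ord s (Ordinal lin)) => lt.
    by exists (Ordinal lin); rewrite eqxx.
  have -> : iota 0 n.+1 = iota 0 n ++ [:: n] by rewrite -[n.+1]addn1 iotaD.
  rewrite count_cat /= ltnn !addn0 -[iota 1 n]/(iota (1 + 0) n) iotaDl count_map.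
  apply: eq_in_count => i; rewrite mem_iota /= add0n => lin; rewrite lin /desc add1n /=.
  suff /eqP : natfun s i != natfun s i.+1 by lia.
  have lin' : i.+1 < n.+1 by [].
  rewrite (natfun_ord s (Ordinal lin')) (natfun_ord s (Ordinal (ltnW lin'))).
  by apply/eqP => /val_inj/perm_inj/(congr1 val) /=; lia.
by rewrite addnC count_predC size_iota.
Qed.

Theorem theorem2p4 (n r : nat) (hn : 1 <= n) :
  #|[set s in involutions132 n | #|rises s| == r]|
  = 'C(n %/ 2, (r + 1) %/ 2) * 'C((n - 1) %/ 2, r %/ 2).
Proof.
rewrite -size_codes // cardE; pose Phi (s : 'S_n) := encode n (desc (natfun s)).
have bnd (s : 'S_n) : s \in involutions132 n -> forall i, desc (natfun s) i -> 0 < i < n.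
  by move=> /natfun_inv132 hs i; exact: desc_bound hs _.
(* [Phi] is a bijection onto the codes: [desc_ballot] places its values there, [ballot_desc] gives
   surjectivity and [inv132_desc_inj] injectivity. *)
rewrite -(size_map Phi); apply/perm_size/uniq_perm; last 1 first.
- case=> w c; rewrite mem_codes; apply/mapP/and4P => [[s]|[/eqP sw bw cn sum]].
    rewrite mem_enum inE => /andP[hs rs] e; have := count_encode hn (bnd _ hs).
    have := card_rises s; rewrite -[encode _ _]/(Phi s) -e /= => cr sum.
    move: e; rewrite /Phi /encode => -[ew ec]; split.
    + by rewrite ew size_word.
    + by rewrite ew; apply/ballot_word/desc_ballot/natfun_inv132.
    + by rewrite ec; apply/implyP => /andP[].
    + by rewrite sum -(eqP rs) addnC cr.
  have [D Dn eD] := encode_surj hn sw (implyP cn).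
  have [|f hf fD] := @ballot_desc n D Dn.
    by apply/ballot_word; move: bw; move/(congr1 fst): eD => /= ->.
  have [s hs sf] := inv132_natfun hf.
  have dD : desc (natfun s) =1 D by move=> i; rewrite -fD /desc !sf.
  exists s; last by rewrite /Phi (eq_encode n dD) eD.
  rewrite mem_enum inE hs /=; have := card_rises s.
  rewrite (eq_count dD) -(count_encode hn Dn) eD /= -(eqP sum) addnC.
  by move/eqP; rewrite eqn_add2l.
- rewrite map_inj_in_uniq ?enum_uniq // => s t; rewrite !mem_enum => /setIdP[hs _] /setIdP[ht _] e.
  apply: natfun_inj; apply: (inv132_desc_inj (natfun_inv132 hs) (natfun_inv132 ht)).
  by apply: encode_inj e; exact: bnd.
- exact: codes_uniq.
Qed.
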